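(* For every spherical curve $P$ (with at least one crossing), $r(P)\le 4$. That is, applying at most four successive inverse-half-twisted splices to $P$ always produces a reducible spherical curve.
   Context: A spherical curve is a smooth immersion $P:S^1\to S^2$ whose self-intersections are finitely many transverse double points, called crossings. The curve is oriented and has at least one crossing. The Gauss word of $P$ is the cyclic word obtained by recording the crossings in the order they are passed when traversing the curve once; each crossing appears exactly twice. Equivalently, the chord diagram of $P$ is the oriented circle $S^1$ with a chord joining the two preimages of each crossing. Two crossings $a,b$ are interlaced if their occurrences alternate $a\dots b\dots a\dots b$ in the cyclic Gauss word, i.e., their chords cross. A crossing $p$ is reducible if no crossing is interlaced with $p$; geometrically, this means only three distinct regions of $S^2\setminus P(S^1)$ meet at $p$ instead of four. $P$ is reducible if it has a reducible crossing, and reduced otherwise. The inverse-half-twisted splice $I$ at a crossing $p$ is defined as follows: if the cyclic Gauss word is $p\,A\,p\,B$, replace a small neighbourhood of $p$ by the smoothing of $p$ that yields a single closed curve (the smoothing not respecting the orientation). The result is a spherical curve with one crossing fewer whose Gauss word is $\overline{A}\,B$, where $\overline{A}$ is $A$ read backwards; it is then re-oriented arbitrarily. The reductivity $r(P)$ is the minimal number of successive applications of $I$ needed to obtain a reducible spherical curve from $P$; in particular $r(P)=0$ if and only if $P$ is reducible. *)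

(* Defs.v *)
From mathcomp Require Import all_boot all_fingroup.
Set Implicit Arguments. Unset Strict Implicit. Unset Printing Implicit Defensive.

(* ---------- Gauss words (cyclic words, represented by a linear seq) ---------- *)
Section GaussWords.
Variable T : eqType.

Definition rot_to (p : T) (w : seq T) : seq T := rot (index p w) w.

Definition arcA (p : T) (w : seq T) : seq T :=
  let r := behead (rot_to p w) in take (index p r) r.
Definition arcB (p : T) (w : seq T) : seq T :=
  let r := behead (rot_to p w) in drop (index p r).+1 r.

(* a and b are interlaced: occurrences alternate a..b..a..b, i.e. b occurs
   exactly once strictly between the two occurrences of a *)
Definition interlaced (w : seq T) (a b : T) : bool :=
  (a != b) && (count_mem b (arcA a w) == 1).

Definition reducible_crossing (w : seq T) (p : T) : bool :=
  (p \in w) && ~~ has (interlaced w p) w.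

Definition reducible (w : seq T) : bool := has (reducible_crossing w) w.

(* inverse-half-twisted splice at p : p A p B  |->  rev(A) B *)
Definition splice (w : seq T) (p : T) : seq T := rev (arcA p w) ++ arcB p w.

Fixpoint reductivity_le (k : nat) (w : seq T) : bool :=
  reducible w ||
  (if k is k'.+1 then has (fun p => reductivity_le k' (splice w p)) w else false).
End GaussWords.

(* A spherical curve with n >= 1 crossings is encoded as a 4-regular map on
   the sphere: darts D, rotation sigma around vertices (crossings), edge
   involution alpha.  The curve goes straight through each crossing:
   leaving along dart d it arrives at alpha d and leaves again along the
   opposite dart sigma^2 (alpha d). *)
Section Maps.
Variable D : finType.
Variables sigma alpha : {perm D}.

Definition curve_step (d : D) : D := sigma (sigma (alpha d)).
Definition face_step (d : D) : D := sigma (alpha d).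

Definition spherical_curve_map : Prop :=
  [/\ forall d, alpha d != d,
      forall d, alpha (alpha d) = d,
      forall d, fingraph.order sigma d = 4,
      fcard curve_step D = 2 &                      (* a single closed curve
                                                       (two traversal directions) *)
      fcard sigma D + fcard face_step D = fcard alpha D + 2 ]. (* V - E + F = 2 *)

(* The Gauss word of the curve starting from dart d0: crossings (named by the
   canonical representative of their sigma-orbit) in the order met. *)
Definition gauss_word (d0 : D) : seq D :=
  map (froot sigma) (traject curve_step d0 (fingraph.order curve_step d0)).
End Maps.

(* Main.v *)
Require Import Defs.
From mathcomp Require Import all_boot all_fingroup zify.
Set Implicit Arguments. Unset Strict Implicit. Unset Printing Implicit Defensive.

(* On interlacement graphs, the splice at [p] is local complementation at [p]
   followed by deletion of [p].  By Euler's formula some face has at most three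
   sides.  A loop edge yields a reducible crossing.  The two corners of a 2-gon are
   twins in the interlacement graph: splicing one of them, after one preliminary
   splice if they are not interlaced, isolates the other.  Every outside crossing is
   interlaced with 0 or 2 corners of a 3-gon; if exactly one of the pairs [ab], [ac]
   of corners is interlaced, one splice makes two corners twins, and a preliminary
   splice at an outside crossing brings the remaining cases to this one. *)

(** * Double occurrence words, their arcs and the splice *)

Section DoubleOccurrence.
Variable T : eqType.
Implicit Types (w A B : seq T) (a b c p x y : T).

Definition double_occ w := forall x, x \in w -> count_mem x w = 2.

Lemma double_occ_split w a : double_occ w -> a \in w ->
  exists w1 A B, [/\ w = w1 ++ a :: A ++ a :: B, a \notin w1, a \notin A & a \notin B].
Proof.
move=> dw aw; have := dw a aw; case/splitPr: aw => w1 w2.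
rewrite count_cat /= eqxx => cnt.
have [aw1|aw1] := boolP (a \in w1).
  move: cnt; case/splitPr: aw1 => A B.
  rewrite count_cat /= eqxx => cnt; exists A, B, w2.
  by rewrite -catA /=; split=> //; rewrite -has_pred1 has_count; lia.
have aw2 : a \in w2.
  by rewrite -has_pred1 has_count; move/count_memPn: aw1 cnt => ->; lia.
move: cnt; case/splitPr: aw2 => A B.
rewrite count_cat /= eqxx => cnt; exists w1, A, B; split=> //.
  by rewrite -has_pred1 has_count; lia.
by rewrite -has_pred1 has_count; lia.
Qed.

Lemma arc_cat w1 A B a : a \notin w1 -> a \notin A ->
  arcA a (w1 ++ a :: A ++ a :: B) = A /\ arcB a (w1 ++ a :: A ++ a :: B) = B ++ w1.
Proof.
move=> aw1 aA.
have rotE : Defs.rot_to a (w1 ++ a :: A ++ a :: B) = a :: A ++ a :: B ++ w1.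
  rewrite /Defs.rot_to index_cat (negPf aw1) /= eqxx addn0 rot_size_cat /=.
  by rewrite -catA.
have idx : index a (A ++ a :: B ++ w1) = size A.
  by rewrite index_cat (negPf aA) /= eqxx addn0.
rewrite /arcA /arcB rotE /= idx take_size_cat //; split=> //.
by rewrite -cat_rcons drop_size_cat // size_rcons.
Qed.

(** Together with [interlaced_filter], this reduces a claim about a few crossings to the subword
    formed by those crossings. *)
Lemma splice_filter (Q : pred T) w p : double_occ w -> p \in w -> Q p ->
  splice (filter Q w) p = filter Q (splice w p).
Proof.
move=> dw pw Qp; case: (double_occ_split dw pw) => w1 [A [B [-> p1 pA pB]]].
rewrite !filter_cat /= filter_cat /= Qp /splice.
have [-> ->] := arc_cat B p1 pA.
have [||-> ->] := @arc_cat (filter Q w1) (filter Q A) (filter Q B) p.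
- by rewrite mem_filter (negPf p1) andbF.
- by rewrite mem_filter (negPf pA) andbF.
by rewrite !(filter_cat, filter_rev).
Qed.

Lemma interlaced_filter (Q : pred T) w a b : double_occ w -> a \in w ->
  Q a -> Q b -> interlaced (filter Q w) a b = interlaced w a b.
Proof.
move=> dw aw Qa Qb; case: (double_occ_split dw aw) => w1 [A [B [-> a1 aA aB]]].
rewrite !filter_cat /= filter_cat /= Qa /interlaced.
have [-> _] := arc_cat B a1 aA.
have [||-> _] := @arc_cat (filter Q w1) (filter Q A) (filter Q B) a.
- by rewrite mem_filter (negPf a1) andbF.
- by rewrite mem_filter (negPf aA) andbF.
rewrite count_filter; congr (_ && (_ == _)); apply: eq_count => z /=.
by case: eqP => //= ->.
Qed.

Lemma perm_splice w p : double_occ w -> p \in w ->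
  perm_eq (splice w p) (filter (predC1 p) w).
Proof.
move=> dw pw; case: (double_occ_split dw pw) => w1 [A [B [-> p1 pA pB]]].
have [eA eB] := arc_cat B p1 pA.
rewrite /splice eA eB !filter_cat /= filter_cat /= eqxx /=.
have idf s : p \notin s -> filter (predC1 p) s = s.
  move=> ps; apply/all_filterP/allP => z zs /=.
  by apply: contraNneq ps => <-.
by rewrite !idf // catA perm_catC perm_cat2l perm_cat2r perm_rev.
Qed.

Lemma mem_splice w p x : double_occ w -> p \in w ->
  (x \in splice w p) = (x != p) && (x \in w).
Proof. by move=> dw pw; rewrite (perm_mem (perm_splice dw pw)) mem_filter. Qed.

Lemma double_occ_splice w p : double_occ w -> p \in w -> double_occ (splice w p).
Proof.
move=> dw pw x; rewrite mem_splice // => /andP[xp xw].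
rewrite (seq.permP (perm_splice dw pw)) count_filter -(dw x xw).
by apply: eq_count => z /=; case: eqP => //= ->.
Qed.

(** * Interlacement through finite checks on few letters *)

Section Transfer.
Variables (K : eqType) (g : K -> T).
Hypothesis g_inj : injective g.

Lemma arcA_map (u : seq K) k : arcA (g k) (map g u) = map g (arcA k u).
Proof. by rewrite /arcA /Defs.rot_to index_map // -map_rot behead_map index_map // map_take. Qed.

Lemma arcB_map (u : seq K) k : arcB (g k) (map g u) = map g (arcB k u).
Proof. by rewrite /arcB /Defs.rot_to index_map // -map_rot behead_map index_map // map_drop. Qed.

Lemma splice_map (u : seq K) k : splice (map g u) (g k) = map g (splice u k).
Proof. by rewrite /splice arcA_map arcB_map map_cat map_rev. Qed.

Lemma interlaced_map (u : seq K) k l : interlaced (map g u) (g k) (g l) = interlaced u k l.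
Proof.
rewrite /interlaced arcA_map inj_eq // count_map; congr (_ && (_ == _)).
by apply: eq_count => z /=; rewrite inj_eq.
Qed.

(** Naming the relevant letters by a concrete type [K] leaves finitely many candidate words [u], so
    that identities between interlacements can be settled by [vm_compute]. *)
Lemma restrict_letters w (ks : seq K) : double_occ w -> uniq ks ->
    (forall k, k \in ks) -> (forall k, g k \in w) ->
  exists2 u, u \in permutations (ks ++ ks) & filter (mem (map g ks)) w = map g u.
Proof.
move=> dw ksU ksT gw.
(* A partial left inverse of [g], found by searching [ks], which exhausts [K]. *)
pose inv z := ohead (filter (fun k => g k == z) ks).
have gK : pcancel g inv.
  move=> k; rewrite /inv (@eq_filter _ _ (pred1 k)) => [|l]; last exact: inj_eq.
  by rewrite filter_pred1_uniq.
pose W := filter (mem (map g ks)) w.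
have gu : W = map g (pmap inv W).
  have : all (mem (map g ks)) W by apply: filter_all.
  elim: W => //= z s IHs /andP[/mapP[k _ ->] /IHs {1}->].
  by rewrite gK.
exists (pmap inv W) => //; rewrite mem_permutations.
apply: (perm_map_inj g_inj); rewrite -gu; apply/allP => z.
rewrite mem_cat map_cat mem_cat mem_filter orbb => /orP zks.
have {zks} /mapP[k _ ->] : z \in map g ks by case: zks => // /andP[].
have gks : g k \in map g ks by apply: map_f.
rewrite /= count_cat !(@count_uniq_mem _ (map g ks)) ?map_inj_uniq // gks.
(* The two memberships sum to [true + true], convertible to the 2 of [dw]. *)
rewrite count_filter -[(true + true)%N](dw _ (gw k)).
by apply/eqP/eq_count => z' /=; case: eqP => //= ->.
Qed.
End Transfer.

(** The definition looks only at the arc of its first crossing; on two letters, symmetry is a check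
    of six words. *)
Lemma interlaced_sym w a b : double_occ w -> a \in w -> b \in w ->
  interlaced w a b = interlaced w b a.
Proof.
move=> dw aw bw; have [->//|ab] := eqVneq a b.
pose g k := if k then a else b.
have g_inj : injective g.
  by move=> [] [] //= /eqP; rewrite ?(negPf ab) // eq_sym (negPf ab).
have [] := @restrict_letters _ g g_inj w [:: true; false] dw.
- by [].
- by case.
- by case.
move=> u uP uE.
rewrite -(@interlaced_filter (mem (map g [:: true; false])) w a b) ?inE ?eqxx ?orbT //.
rewrite -(@interlaced_filter (mem (map g [:: true; false])) w b a) ?inE ?eqxx ?orbT //.
rewrite uE -[a]/(g true) -[b]/(g false) !interlaced_map //.
have /allP/(_ u uP)/eqP// : all (fun u => interlaced u true false == interlaced u false true)
  (permutations [:: true; false; true; false]) by vm_compute.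
Qed.

(* Only the letters [p], [x], [y] matter, which leaves the 90 words with two
   occurrences of each of three letters to be checked by computation. *)
Lemma interlaced_splice w p x y : double_occ w -> p \in w -> x \in w -> y \in w ->
    x != p -> y != p -> x != y ->
  interlaced (splice w p) x y = interlaced w x y (+) interlaced w p x && interlaced w p y.
Proof.
move=> dw pw xw yw xp yp xy.
pose g k := if k is Some b then if b then x else y else p.
pose ks := [:: None; Some true; Some false].
have g_inj : injective g.
  have nE := (negPf xp, negPf yp, negPf xy).
  by move=> [[]|] [[]|] //= /eqP; rewrite ?nE // eq_sym nE.
have [||[[]|]|u uP uE] // := @restrict_letters _ g g_inj w ks dw.
  by case=> [[]|].
pose Q := mem (map g ks).
have [Qp Qx Qy] : [/\ Q p, Q x & Q y] by rewrite /Q /= !inE !eqxx !orbT.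
rewrite -(@interlaced_filter Q w x y) // -(@interlaced_filter Q w p x) //.
rewrite -(@interlaced_filter Q w p y) // -(@interlaced_filter Q (splice w p) x y) //.
- rewrite -splice_filter // uE -[p]/(g None) -[x]/(g (Some true)) -[y]/(g (Some false)).
  rewrite splice_map // !interlaced_map //.
  have /allP/(_ u uP)/eqP// : all (fun u => interlaced (splice u None) (Some true) (Some false)
      == interlaced u (Some true) (Some false)
         (+) interlaced u None (Some true) && interlaced u None (Some false))
    (permutations (ks ++ ks)) by vm_compute.
- exact: double_occ_splice.
- by rewrite mem_splice // xp.
Qed.

(** The two prefixes differ by [a] and its arc, which contains [x] at most twice, hence exactly once
    when the parity changes. Interlacement becomes a difference of two parities attached to
    positions on the curve. *)
Lemma interlaced_prefix w a x i j x0 : double_occ w -> a != x ->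
    i < j < size w -> nth x0 w i = a -> nth x0 w j = a ->
  interlaced w a x = odd (count_mem x (take i w)) (+) odd (count_mem x (take j w)).
Proof.
move=> dw ax /andP[ij jw] wi wj.
pose w1 := take i w; pose A := take (j - i.+1) (drop i.+1 w); pose B := drop j.+1 w.
have iw := ltn_trans ij jw.
have wE : w = w1 ++ a :: A ++ a :: B.
  rewrite -{1}(cat_take_drop i w) (drop_nth x0) // wi; congr (_ ++ _ :: _).
  rewrite -{1}(cat_take_drop (j - i.+1) (drop i.+1 w)) drop_drop subnK //.
  by rewrite (drop_nth x0 jw) wj.
have sA : size A = j - i.+1 by rewrite size_takel // size_drop leq_sub2r // ltnW.
have take_j : take j w = w1 ++ a :: A.
  rewrite {1}wE -(cat1s _ (_ ++ _)) !catA take_size_cat -?catA //.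
  by rewrite !size_cat /= sA size_takel ?(ltnW iw) //; lia.
have aw : a \in w by rewrite -wi mem_nth.
have cnt : count_mem a w1 + count_mem a A = 0.
  by have := dw _ aw; rewrite {1}wE count_cat /= count_cat /= eqxx; lia.
have [aw1 aA] : a \notin w1 /\ a \notin A.
  by rewrite -!has_pred1 !has_count; lia.
have [arcE _] := arc_cat B aw1 aA.
rewrite /interlaced ax take_j count_cat /= (negPf ax) add0n oddD addKb {1}wE arcE.
have : count_mem x A <= 2.
  have [/dw <-|xw] := boolP (x \in w).
    by rewrite {1}wE count_cat /= count_cat; lia.
  suff /count_memPn -> : x \notin A by [].
  by apply: contra xw => xA; rewrite wE mem_cat inE mem_cat xA !orbT.
by case: (count_mem x A) => [|[|[]]].
Qed.

(** * Bounds on reductivity and isolated crossings *)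

Lemma reductivity_leS k w : reductivity_le k w -> reductivity_le k.+1 w.
Proof.
elim: k w => [|k IHk] w; first by rewrite /= orbF => ->.
case/orP=> [rw|/hasP[p pw /IHk rp]]; first by rewrite /= rw.
by apply/orP; right; apply/hasP; exists p.
Qed.

Lemma reductivity_leW k l w : k <= l -> reductivity_le k w -> reductivity_le l w.
Proof.
move/subnK <-; elim: (l - k) => // m IHm /IHm; exact: reductivity_leS.
Qed.

Lemma reductivity_le_splice k w p : p \in w ->
  reductivity_le k (splice w p) -> reductivity_le k.+1 w.
Proof. by move=> pw rp; apply/orP; right; apply/hasP; exists p. Qed.

Lemma reducible_le k w : reducible w -> reductivity_le k w.
Proof. by case: k => [|k] /= ->. Qed.

Lemma isolated_reducible w a : a \in w ->
  (forall x, x \in w -> x != a -> ~~ interlaced w a x) -> reducible w.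
Proof.
move=> aw isol; apply/hasP; exists a => //; rewrite /reducible_crossing aw.
apply/hasPn => x xw; have [->|xa] := eqVneq x a; last exact: isol.
by rewrite /interlaced eqxx.
Qed.

Lemma reducible_or_interlaced w a : a \in w -> reducible w \/
  exists x, [/\ x \in w, x != a & interlaced w a x].
Proof.
move=> aw; have [/hasP[x xw ax]|nax] := boolP (has (interlaced w a) w).
  by right; exists x; split=> //; rewrite eq_sym; case/andP: ax.
by left; apply: (isolated_reducible aw) => x xw _; apply: (hasPn nax).
Qed.

(** * Twins and triangular triples in the interlacement graph *)

Definition twins w a b := forall x, x \in w -> x != a -> x != b ->
  interlaced w a x = interlaced w b x.

(** Local complementation at [a] adds the neighbours of [a] to those of [b] modulo 2; the two sets
    agree, so [b] becomes isolated. *)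
Lemma twins_interlaced w a b : double_occ w -> a \in w -> b \in w -> a != b ->
  twins w a b -> interlaced w a b -> reductivity_le 1 w.
Proof.
move=> dw aw bw ab tw iab; apply: (reductivity_le_splice aw).
apply/reducible_le/(@isolated_reducible _ b).
  by rewrite mem_splice // eq_sym ab.
move=> x; rewrite mem_splice // => /andP[xa xw] xb.
by rewrite interlaced_splice // 1?eq_sym // iab tw //= addbb.
Qed.

Lemma twins_le2 w a b : double_occ w -> a \in w -> b \in w -> a != b ->
  twins w a b -> reductivity_le 2 w.
Proof.
move=> dw aw bw ab tw.
have [iab|niab] := boolP (interlaced w a b).
  exact/reductivity_leS/(twins_interlaced dw aw bw).
(* Unless [a] is isolated, it shares a neighbour [x] with [b]. Splicing at [x] makes [a] and [b]
   interlaced and changes their other neighbours alike, so they stay twins. *)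
have [/reducible_le//|[x [xw xa iax]]] := reducible_or_interlaced aw.
have xb : x != b by apply: contraNneq niab => <-.
have ixa : interlaced w x a by rewrite interlaced_sym.
have ixb : interlaced w x b by rewrite interlaced_sym // -tw.
apply: (reductivity_le_splice xw); apply: (@twins_interlaced _ a b) => //.
- exact: double_occ_splice.
- by rewrite mem_splice // eq_sym xa.
- by rewrite mem_splice // eq_sym xb.
- move=> y; rewrite mem_splice // => /andP[yx yw] ya yb.
  by rewrite !interlaced_splice // 1?eq_sym // tw // ixa ixb.
- by rewrite interlaced_splice // 1?eq_sym // (negPf niab) ixa ixb.
Qed.

(** The parity form of being interlaced with 0 or 2 corners of a 3-gon, additive like local
    complementation. *)
Definition triangular w a b c := forall x, x \in w -> x != a -> x != b -> x != c ->
  interlaced w a x (+) interlaced w b x (+) interlaced w c x = false.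

Section Triangular.
Variables (w : seq T) (a b c : T).
Hypotheses (dw : double_occ w) (aw : a \in w) (bw : b \in w) (cw : c \in w).
Hypotheses (ab : a != b) (ac : a != c) (bc : b != c).
Hypothesis tri : triangular w a b c.

(* Splicing at [a] adds the neighbours of [a] to those of [b], which by
   triangularity makes [b] a twin of [c]. *)
Lemma triangular_le3 : interlaced w a b -> ~~ interlaced w a c -> reductivity_le 3 w.
Proof.
move=> iab niac; apply: (reductivity_le_splice aw).
apply: (@twins_le2 _ b c) => //.
- exact: double_occ_splice.
- by rewrite mem_splice // eq_sym ab.
- by rewrite mem_splice // eq_sym ac.
move=> x; rewrite mem_splice // => /andP[xa xw] xb xc.
rewrite !interlaced_splice // 1?eq_sym // iab (negPf niac) /= addbF.
by have := tri xw xa xb xc; do 3!case: (interlaced _ _ x).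
Qed.

(* Splicing at an outer neighbour [x] of [a] and [b] toggles the interlacement of
   [a] and [b] and of no other pair among [a], [b], [c]. *)
Lemma triangular_toggle x : x \in w -> x != a -> x != b -> x != c ->
    interlaced w a x -> interlaced w b x ->
  [/\ triangular (splice w x) a b c,
      interlaced (splice w x) a b = ~~ interlaced w a b &
      interlaced (splice w x) a c = interlaced w a c].
Proof.
move=> xw xa xb xc iax ibx.
have nicx : interlaced w c x = false by have := tri xw xa xb xc; rewrite iax ibx.
have ixa : interlaced w x a by rewrite interlaced_sym.
have ixb : interlaced w x b by rewrite interlaced_sym.
have nixc : interlaced w x c = false by rewrite interlaced_sym.
split.
- move=> y; rewrite mem_splice // => /andP[yx yw] ya yb yc.
  rewrite !interlaced_splice // 1?eq_sym // ixa ixb nixc /= addbF.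
  have := tri yw ya yb yc.
  by do 3!case: (interlaced _ _ y) => //; case: (interlaced _ _ y).
- by rewrite interlaced_splice // 1?eq_sym // ixa ixb addbT.
- by rewrite interlaced_splice // 1?eq_sym // ixa nixc addbF.
Qed.
End Triangular.

Lemma triangularC w a b c : triangular w a b c -> triangular w a c b.
Proof. by move=> tri x xw xa xc xb; rewrite addbAC tri. Qed.

Lemma triangular_neq_le3 w a b c : double_occ w -> a \in w -> b \in w -> c \in w ->
    a != b -> a != c -> b != c -> triangular w a b c ->
  interlaced w a b != interlaced w a c -> reductivity_le 3 w.
Proof.
move=> dw aw bw cw ab ac bc tri.
have [iab|niab] := boolP (interlaced w a b).
  by rewrite eq_sym eqb_id => niac; apply: (triangular_le3 dw aw bw cw).
have cb : c != b by rewrite eq_sym.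
rewrite eq_sym eqbF_neg negbK => iac.
exact: (triangular_le3 dw aw cw bw ac ab cb (triangularC tri)).
Qed.

(** The splice at [x] toggles [ab] but not [ac], so the two become different and three more splices
    suffice. *)
Lemma triangular_le4_outer w a b c x : double_occ w ->
    a \in w -> b \in w -> c \in w -> a != b -> a != c -> b != c -> triangular w a b c ->
    interlaced w a b = interlaced w a c ->
    x \in w -> x != a -> x != b -> x != c -> interlaced w a x -> interlaced w b x ->
  reductivity_le 4 w.
Proof.
move=> dw aw bw cw ab ac bc tri iabc xw xa xb xc iax ibx.
have [tri' iab' iac'] := triangular_toggle dw aw bw cw ab ac tri xw xa xb xc iax ibx.
apply: (reductivity_le_splice xw).
apply: (@triangular_neq_le3 _ a b c) => //; try by rewrite mem_splice // eq_sym ?xa ?xb ?xc.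
  exact: double_occ_splice.
by rewrite iab' iac' iabc; case: (interlaced w a c).
Qed.

Lemma triangular_le4 w a b c : double_occ w -> a \in w -> b \in w -> c \in w ->
  a != b -> a != c -> b != c -> triangular w a b c -> reductivity_le 4 w.
Proof.
move=> dw aw bw cw ab ac bc tri.
have cb : c != b by rewrite eq_sym.
have [iabc|/triangular_neq_le3 le3] := eqVneq (interlaced w a b) (interlaced w a c); last first.
  exact/reductivity_leS/le3.
(* By triangularity an outer neighbour of [a] is also a neighbour of [b] or of [c], which selects
   the pair to toggle. *)
have [/hasP[x xw /and4P[xa xb xc iax]]|/hasPn noouter] :=
    boolP (has (fun x => [&& x != a, x != b, x != c & interlaced w a x]) w).
  have [ibx|nibx] := boolP (interlaced w b x).
    exact: (triangular_le4_outer dw aw bw cw ab ac bc tri iabc xw).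
  have icx : interlaced w c x.
    by have := tri x xw xa xb xc; rewrite iax (negPf nibx); case: (interlaced w c x).
  exact: (triangular_le4_outer dw aw cw bw ac ab cb (triangularC tri) (esym iabc) xw).
have niax x : x \in w -> x != a -> x != b -> x != c -> interlaced w a x = false.
  by move=> xw xa xb xc; have := noouter x xw; rewrite xa xb xc => /negPf.
(* Without outer neighbours, [a] is either isolated or interlaced with exactly [b] and [c]. *)
have [iab|niab] := boolP (interlaced w a b); last first.
  apply/reducible_le/(isolated_reducible aw) => x xw xa.
  have [->//|xb] := eqVneq x b.
  have [->|xc] := eqVneq x c; first by rewrite -iabc.
  by rewrite niax.
(* As [a] has no outer neighbour, splicing there changes no interlacement of [b] or [c] with an
   outer crossing, and triangularity says that these agree. *)
apply: (@reductivity_leW 3) => //; apply: (reductivity_le_splice aw).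
apply: (@twins_le2 _ b c) => //.
- exact: double_occ_splice.
- by rewrite mem_splice // eq_sym ab.
- by rewrite mem_splice // eq_sym ac.
move=> x; rewrite mem_splice // => /andP[xa xw] xb xc.
rewrite !interlaced_splice // 1?eq_sym // (niax x) // !andbF !addbF.
by have := tri x xw xa xb xc; rewrite (niax x) //; do 2!case: (interlaced _ _ x).
Qed.
End DoubleOccurrence.

(** * Orbits of darts and the Gauss word of a spherical map *)

Lemma sum_order_roots (D : finType) (f : D -> D) : injective f ->
  \sum_(r in froots f) fingraph.order f r = #|D|.
Proof.
move=> f_inj; rewrite -sum1_card [RHS](partition_big (froot f) (mem (froots f))) /=; last first.
  by move=> d _; apply: roots_root; apply: fconnect_sym.
apply: eq_bigr => r rr; rewrite sum1_card /fingraph.order.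
apply: eq_card => d; rewrite !inE /=.
by rewrite -(root_connect (fconnect_sym f_inj)) (eqP rr) eq_sym.
Qed.


Section SphericalMap.
Variables (D : finType) (sigma alpha : {perm D}) (d0 : D).
Hypothesis map_ok : spherical_curve_map sigma alpha.

Let c := curve_step sigma alpha.
Let f := face_step sigma alpha.
Let v := froot sigma.
(** The darts along which the traversal from [d0] leaves a crossing; the remaining darts belong to
    the reverse traversal. *)
Let O := fconnect c d0.
Let m := fingraph.order c d0.
Let w := gauss_word sigma alpha d0.

Lemma alpha_neq d : alpha d != d. Proof. by case: map_ok. Qed.
Lemma alphaK d : alpha (alpha d) = d. Proof. by case: map_ok. Qed.
Lemma order_sigma d : fingraph.order sigma d = 4. Proof. by case: map_ok. Qed.

Lemma sigma4 d : sigma (sigma (sigma (sigma d))) = d.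
Proof. by have := @iter_order _ sigma (@perm_inj _ sigma) d; rewrite order_sigma. Qed.

Lemma sigma_orbit_uniq d : uniq [:: d; sigma d; sigma (sigma d); sigma (sigma (sigma d))].
Proof. by have := fingraph.orbit_uniq sigma d; rewrite /fingraph.orbit order_sigma. Qed.

Lemma vertexP d e : reflect (v d = v e)
  (e \in [:: d; sigma d; sigma (sigma d); sigma (sigma (sigma d))]).
Proof.
have -> : (e \in [:: d; sigma d; sigma (sigma d); sigma (sigma (sigma d))]) = fconnect sigma d e.
  by rewrite fconnect_orbit /fingraph.orbit order_sigma.
by apply: (rootP (fconnect_sym (@perm_inj _ sigma))).
Qed.

Lemma vertex_sigma d : v (sigma d) = v d.
Proof. by apply/esym/vertexP; rewrite !inE eqxx orbT. Qed.

Lemma curve_inj : injective c.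
Proof. by move=> d e /perm_inj/perm_inj/perm_inj. Qed.

Lemma curve_step_alphaK d : c (alpha (c d)) = alpha d.
Proof. by rewrite /c /curve_step alphaK sigma4. Qed.

(* [alpha] conjugates [c] to its inverse, so an orbit stable under [alpha] would
   contain a fixed point of [alpha] or of [sigma^2]. *)
Lemma curve_not_reversed d : ~~ fconnect c d (alpha d).
Proof.
apply/negP => /iter_findex; move: (findex _ _ _) => k.
elim/ltn_ind: k d => -[|[|k]] IHk d /=.
- by move/esym/eqP; rewrite (negPf (alpha_neq d)).
- rewrite /c /curve_step => /eqP e; have := sigma_orbit_uniq (alpha d).
  by rewrite /= !inE (eqP e) eqxx !orbT.
(* Removing one step at each end passes from [d] to [c d] and shortens the path by two. *)
rewrite -(curve_step_alphaK d) => /curve_inj; rewrite -iterS iterSr.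
exact: (IHk k).
Qed.

Lemma curve_alpha d e : fconnect c d e -> fconnect c (alpha d) (alpha e).
Proof.
move/iter_findex => <-; rewrite fconnect_sym; last exact: curve_inj.
elim: (findex _ _ _) => [|k IHk] //=; apply: connect_trans IHk.
by rewrite -[X in fconnect _ _ X]curve_step_alphaK fconnect1.
Qed.

(** The orbits of [d0] and [alpha d0] differ by [curve_not_reversed], so they are the only two
    orbits of [c]. *)
Lemma curve_cover d : O d || O (alpha d).
Proof.
have csym := fconnect_sym curve_inj.
have [_ _ _ nc _] := map_ok.
pose r1 := froot c d0; pose r2 := froot c (alpha d0).
have r12 : r1 != r2.
  apply: contra (curve_not_reversed d0) => /eqP /(rootP csym); exact.
have roots_root d' : froot c d' \in [set r1; r2].
  suff -> : [set r1; r2] = [set r | r \in froots c].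
    by rewrite inE; apply: roots_root csym _.
  apply/eqP; rewrite eqEcard cards2 r12 cardsE.
  have -> : #|froots c| = 2 by rewrite -nc; apply: eq_card => r; rewrite !inE andbT.
  rewrite andbT; apply/subsetP => r; rewrite !inE => /orP[] /eqP->; exact: roots_root.
have := roots_root d; rewrite !inE => /orP[] /eqP /esym/(rootP csym); rewrite /O; first by move->.
by move/curve_alpha; rewrite alphaK => ->; apply: orbT.
Qed.

(** The dart opposite to [d] is [c (alpha d)], hence in the orbit of [alpha d], the reverse of that
    of [d]. *)
Lemma curve_sigma2 d : O (sigma (sigma d)) = ~~ O d.
Proof.
have -> : O (sigma (sigma d)) = O (alpha d).
  rewrite -[in LHS](alphaK d) -[sigma _]/(c (alpha d)) /O.
  by rewrite -(same_fconnect1_r curve_inj).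
have := curve_cover d; case Od: (O d); case Oad: (O (alpha d)) => //= _.
have := curve_not_reversed d.
by rewrite (connect_trans _ Oad) // fconnect_sym //; apply: curve_inj.
Qed.

Lemma curve_alphaE d : O (alpha d) = ~~ O d.
Proof.
rewrite -curve_sigma2 -[in RHS](alphaK d) -[sigma _]/(c (alpha d)) /O.
by rewrite -(same_fconnect1_r curve_inj).
Qed.

Lemma double_occ_gauss_word : double_occ w.
Proof.
move=> x /mapP[d]; rewrite -[traject _ _ _]/(fingraph.orbit c d0) -fconnect_orbit => Od ->{x}.
rewrite count_map -size_filter.
(* The other strand through the crossing leaves along whichever of its two opposite darts lies in
   [O]. *)
pose e := if O (sigma d) then sigma d else sigma (sigma (sigma d)).
rewrite (@perm_size _ _ [:: d; e]) //; apply: uniq_perm.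
- by rewrite filter_uniq // fingraph.orbit_uniq.
- have := sigma_orbit_uniq d; rewrite /e /= !inE !negb_or !andbT.
  by case/andP=> /and3P[n1 n2 n3] _; case: ifP.
move=> a; rewrite mem_filter -fconnect_orbit -/(O a) !inE /=.
have -> : (froot sigma a == froot sigma d) =
    (a \in [:: d; sigma d; sigma (sigma d); sigma (sigma (sigma d))]).
  by rewrite eq_sym; apply: (sameP eqP); apply: vertexP.
have := curve_sigma2 d; have := curve_sigma2 (sigma d); rewrite /e [O d]Od !inE.
have := sigma_orbit_uniq d; rewrite /= !inE !negb_or !andbT.
case/and3P=> /and3P[n1 n2 n3] /andP[n4 n5] n6 O3 O2.
have [->|a0] := eqVneq a d; first by rewrite [O d]Od.
have [->|a1] := eqVneq a (sigma d).
  by case: (O (sigma d)) => //=; rewrite ?eqxx // (negPf n5).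
have [->|a2] := eqVneq a (sigma (sigma d)).
  by rewrite O2; case: (O (sigma d)); rewrite /= ?(negPf n6) // eq_sym (negPf n4).
have [->|a3] := eqVneq a (sigma (sigma (sigma d))).
  by rewrite O3; case: (O (sigma d)); rewrite /= ?eqxx // eq_sym (negPf n5).
by case: (O (sigma d)); rewrite ?(negPf a1) ?(negPf a3).
Qed.

(** The outgoing dart of the strand that passes through [d], representing one passage of the
    curve. *)
Let rep d := if O d then d else sigma (sigma d).

Lemma rep_curve d : O (rep d).
Proof. by rewrite /rep; case: ifP => // nOd; rewrite curve_sigma2 nOd. Qed.

Lemma vertex_rep d : v (rep d) = v d.
Proof. by rewrite /rep; case: ifP => // _; rewrite !vertex_sigma. Qed.

Lemma rep_sigma_neq d : rep d != rep (sigma d).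
Proof.
have := sigma_orbit_uniq d; rewrite /rep /= !inE !negb_or !andbT.
case/and3P=> /and3P[n1 _ n3] /andP[n4 _] n6.
by do 2![case: ifP => _] => //; rewrite eq_sym.
Qed.

(** Otherwise [c] would fix [rep d], and the traversal would be a single dart, although the two
    strands at the crossing give two. *)
Lemma alpha_neq_sigma2 d : alpha d != sigma (sigma d).
Proof.
apply/negP => /eqP adE; have fix_rep : c (rep d) = rep d.
  by rewrite /rep /c /curve_step; case: ifP => _; rewrite -?adE ?alphaK // adE sigma4.
have csym := fconnect_sym curve_inj.
have : fconnect c (rep d) (rep (sigma d)).
  by apply: connect_trans (rep_curve (sigma d)); rewrite csym; apply: rep_curve.
case/iter_findex/esym/eqP; elim: (findex _ _ _) => [|k IHk]; last by rewrite iterSr fix_rep.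
by rewrite eq_sym (negPf (rep_sigma_neq d)).
Qed.

(** * Positions in the Gauss word and sides of a chord *)

Lemma size_gauss_word : size w = m.
Proof. by rewrite size_map size_traject. Qed.

Lemma nth_gauss_word x0 d : O d -> nth x0 w (findex c d0 d) = v d.
Proof.
move=> Od; have ltm := findex_max Od.
by rewrite (nth_map d0) ?size_traject // nth_traject // iter_findex.
Qed.

Lemma vertex_gauss_word d : v d \in w.
Proof.
rewrite -vertex_rep -(nth_gauss_word d0 (rep_curve d)) mem_nth // size_gauss_word.
exact: findex_max (rep_curve d).
Qed.

(* The side of the chord of [x] on which the passage of the curve through [d] lies;
   meaningful only when [d] is not at [x]. *)
Let side x d := odd (count_mem x (take (findex c d0 (rep d)) w)).

Lemma side_sigma2 x d : side x (sigma (sigma d)) = side x d.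
Proof. by rewrite /side /rep curve_sigma2; case: (O d) => //=; rewrite sigma4. Qed.

(** Following an edge lengthens the prefix by the letter [v d] alone, which is not [x]. *)
Lemma side_alpha_curve x d : O d -> x \in w -> v d != x -> side x (alpha d) = side x d.
Proof.
move=> Od xw dx; rewrite /side /rep Od curve_alphaE Od /= -[sigma _]/(c d).
have [iw|iw] := ltnP (findex c d0 d).+1 m.
  have -> : findex c d0 (c d) = (findex c d0 d).+1.
    by rewrite -{1}(iter_findex Od) -iterS findex_iter.
  rewrite (take_nth d0) ?size_gauss_word ?(ltnW iw) // nth_gauss_word //.
  by rewrite -cats1 count_cat /= (negPf dx) !addn0.
(* On the last edge the prefix drops from nearly all of [w] to the empty word; [x] occurs twice in
   [w], so the parity is unchanged. *)
have im : (findex c d0 d).+1 = m by apply/eqP; rewrite eqn_leq iw andbT; apply: findex_max.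
have -> : c d = d0.
  by rewrite -{1}(iter_findex Od) -iterS im; apply: iter_order curve_inj _.
rewrite findex0 take0 /=; have := double_occ_gauss_word xw.
rewrite -{1}(take_size w) size_gauss_word -im (take_nth d0) ?size_gauss_word -?im //.
by rewrite nth_gauss_word // -cats1 count_cat /= (negPf dx) !addn0 => ->.
Qed.

Lemma side_alpha x d : x \in w -> v d != x -> v (alpha d) != x -> side x (alpha d) = side x d.
Proof.
move=> xw dx adx; have [Od|nOd] := boolP (O d); first exact: side_alpha_curve.
by rewrite -[in RHS](alphaK d) [RHS]side_alpha_curve // curve_alphaE.
Qed.

(** The darts [d] and [sigma d] lie on the two strands of the crossing, so [interlaced_prefix]
    applies to the positions of their passages, in either order. *)
Lemma interlaced_side x d : v d != x ->
  interlaced w (v d) x = side x d (+) side x (sigma d).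
Proof.
move=> dx; have dw := double_occ_gauss_word.
have [Oi Oj] := (rep_curve d, rep_curve (sigma d)).
have wi := nth_gauss_word d0 Oi; have wj := nth_gauss_word d0 Oj.
have [im jm] := (findex_max Oi, findex_max Oj).
rewrite vertex_rep in wi; rewrite vertex_rep vertex_sigma in wj.
rewrite /side; case: (ltngtP (findex c d0 (rep d)) (findex c d0 (rep (sigma d)))) => ij.
- by apply: interlaced_prefix wi wj; rewrite ?ij ?size_gauss_word.
- by rewrite addbC; apply: interlaced_prefix wj wi; rewrite ?ij ?size_gauss_word.
have : rep d = rep (sigma d) by rewrite -(iter_findex Oi) ij iter_findex.
by move/eqP; rewrite (negPf (rep_sigma_neq d)).
Qed.

(** The dart [sigma (f d)] is opposite to [alpha d], hence on the side of [d]. Around a face these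
    differences of sides cancel. *)
Lemma corner x d : x \in w -> v d != x -> v (f d) != x ->
  interlaced w (v (f d)) x = side x d (+) side x (f d).
Proof.
move=> xw dx fdx; rewrite interlaced_side // addbC; congr (_ (+) _).
have adx : v (alpha d) != x by rewrite -vertex_sigma.
by rewrite /f /face_step side_sigma2 side_alpha.
Qed.

(** The ends of a loop edge lie on different strands of the crossing, so both strands are on the
    same side of every other chord. *)
Lemma loop_reducible d : v (alpha d) = v d -> reducible w.
Proof.
move=> ad; apply: (isolated_reducible (vertex_gauss_word d)) => x xw xd.
have dx : v d != x by rewrite eq_sym.
have adx : v (alpha d) != x by rewrite ad.
rewrite interlaced_side // -(side_alpha xw dx adx).
have /vertexP := esym ad; rewrite !inE => /or4P[]/eqP adE.
- by have := alpha_neq d; rewrite adE eqxx.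
- by rewrite adE addbb.
- by have := alpha_neq_sigma2 d; rewrite adE eqxx.
- by rewrite adE side_sigma2 addbb.
Qed.

(** Here [4V = 2E = #|D|]. If every face had at least four sides, then [4F <= #|D|], so
    [V + F <= E], against Euler's formula. *)
Lemma order_face_le3 : exists d, fingraph.order f d <= 3.
Proof.
have f_inj : injective f by move=> d e /perm_inj/perm_inj.
have [/existsP//|/existsPn no_small] := boolP [exists d, fingraph.order f d <= 3].
have fcard_froots g : fcard g D = #|froots g| by apply: eq_card => d; rewrite !inE andbT.
have card_sigma : fcard sigma D * 4 = #|D|.
  by apply: (fcard_order_set perm_inj) => //; apply/subsetP => d _; rewrite inE order_sigma.
have card_alpha : fcard alpha D * 2 = #|D|.
  apply: (fcard_order_set perm_inj) => //; apply/subsetP => d _.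
  rewrite inE /fingraph.order (@eq_card _ _ (mem [:: d; alpha d])).
    by apply/eqP/card_uniqP; rewrite /= inE eq_sym alpha_neq.
  move=> e; rewrite !inE; apply/idP/orP => [/iter_findex <-|[]/eqP->].
  - elim: (findex _ _ _) => [|k []/eqP /= ->]; rewrite ?eqxx ?alphaK; auto.
  - exact: connect0.
  - exact: fconnect1.
have card_face : fcard f D * 4 <= #|D|.
  rewrite -(sum_order_roots f_inj) fcard_froots -sum_nat_const.
  by apply: leq_sum => d _; rewrite ltnNge.
case: map_ok => _ _ _ _ euler; move: euler card_sigma card_alpha card_face.
rewrite -/f; lia.
Qed.

Lemma gauss_word_reductivity_le4 : reductivity_le 4 w.
Proof.
have dw := double_occ_gauss_word; have vw := vertex_gauss_word.
have f_inj : injective f by move=> d e /perm_inj/perm_inj.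
have vf d : v (f d) = v (alpha d) by rewrite vertex_sigma.
have [d le3] := order_face_le3.
have : [\/ f d = d, f (f d) = d | f (f (f d)) = d].
  have := @iter_order _ f f_inj d.
  case: (fingraph.order f d) (fingraph.order_gt0 f d) le3 => [|[|[|[|k]]]] // _ _ fd.
  - exact: Or31.
  - exact: Or32.
  - exact: Or33.
have loop e : v (f e) = v e -> reductivity_le 4 w.
  by move=> fe; apply/reducible_le/(loop_reducible (d := e)); rewrite -vf.
(* Equal consecutive corners reveal a loop edge, so afterwards consecutive corners are distinct. *)
have [/loop //|f0] := eqVneq (v (f d)) (v d).
have [/loop //|f1] := eqVneq (v (f (f d))) (v (f d)).
have [/loop //|f2] := eqVneq (v (f (f (f d)))) (v (f (f d))).
case=> fd; first by rewrite fd eqxx in f0.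
  apply: (@reductivity_leW _ 2) => //.
  apply: (@twins_le2 _ _ (v (f d)) (v d)) => // x xw.
  rewrite ![x == _]eq_sym => x1 x0.
  by rewrite -[in RHS]fd !corner ?fd //; apply: addbC.
rewrite fd in f2.
apply: (@triangular_le4 _ _ (v d) (v (f d)) (v (f (f d)))); rewrite 1?eq_sym //.
  by rewrite eq_sym.
move=> x xw; rewrite ![x == _]eq_sym => x0 x1 x2.
(* Writing [d] as [f (f (f d))] makes [corner] apply at all three vertices; each side then enters
   two of the three differences. *)
rewrite -{1}fd !corner ?fd //.
by case: (side x d); case: (side x (f d)); case: (side x (f (f d))).
Qed.
End SphericalMap.

Theorem theorem1 (D : finType) (sigma alpha : {perm D}) (d0 : D) :
  spherical_curve_map sigma alpha ->
  reductivity_le 4 (gauss_word sigma alpha d0).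
Proof. exact: gauss_word_reductivity_le4. Qed.
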